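(* Let $G=(V,E)$ be a finite connected digraph, $\ell\in\mathbb{R}^E$ with $\ell_{ij}>0$ for all $ij\in E$, and $b\in\mathbb{R}^V$ with $\sum_{i\in V} b_i=0$. Assume that the transshipment problem ''minimise $\ell^{T}f$ over $f\in\mathbb{R}^E$ subject to $Bf=b$, $f\ge 0$'' is feasible, i.e. $\Phi^+\neq\emptyset$. Let $\sigma(t)$, $t\ge 0$, be the conductivity vector of the Physarum Solver for $(G,b,\ell)$ started from an arbitrary initial state $\sigma(0)\in\mathbb{R}^E$ with $\sigma_{ij}(0)>0$ for all $ij\in E$, and let $\phi(t)$ be the corresponding current. Then there is an optimal flow $\hat\phi\in\hat\Phi$ to which $\phi(t)$ converges exponentially fast: there exist constants $a>0$ and $T\ge 0$ such that $$|\phi_{ij}(t)-\hat\phi_{ij}|\le e^{-a t}\qquad\text{for all } ij\in E \text{ and all } t\ge T .$$ Moreover, the limit flow $\hat\phi$ has full support on the optimal set, i.e. $\operatorname{supp}\hat\phi=\{ij\in E:\hat\phi_{ij}\neq 0\}=E(\hat H)$.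
   Context: Digraphs have no loops and no multiple arcs (a pair of opposite arcs $ij,ji$ is allowed); a digraph is connected if its underlying undirected graph is connected. For an arc $ij$, $i$ is the tail and $j$ the head. The boundary operator is $B\in\mathbb{R}^{V\times E}$ with $B_{ie}=+1$ if $i$ is the tail of $e$, $B_{ie}=-1$ if $i$ is the head of $e$, and $B_{ie}=0$ otherwise. A flow is a vector $f\in\mathbb{R}^E$ with $Bf=b$; it is positive if $f_{ij}\ge 0$ for all $ij$. $\Phi^+=\{f\in\mathbb{R}^E: Bf=b,\ f\ge 0\}$ is the set of positive flows, and $\hat\Phi\subset\Phi^+$ is the set of positive flows minimising the cost $\ell(f)=\ell^{T}f=\sum_{ij\in E}\ell_{ij}f_{ij}$ over $\Phi^+$. The optimal set $\hat H$ is the subgraph of $G$ induced by the arc set $E(\hat H)=\bigcup_{f\in\hat\Phi}\operatorname{supp} f$. Physarum Solver: given a conductivity vector $\sigma\in\mathbb{R}^E$ with all entries positive, let $L(\sigma)=B\,\mathrm{diag}(\sigma/\ell)\,B^{T}$ and let $p\in\mathbb{R}^V$ be the solution of $L(\sigma)p=b$ with $\min_i p_i=0$ (unique since $G$ is connected). The corresponding current is $\phi_{ij}=\sigma_{ij}(p_i-p_j)/\ell_{ij}$, $ij\in E$. The conductivity vector $\sigma(t)=(\sigma_{ij}(t))_{ij\in E}$ evolves for $t\ge0$ according to $$\frac{d}{dt}\sigma_{ij}(t)+\sigma_{ij}(t)=\phi_{ij}(t),\qquad ij\in E,$$ where $p(t)$ and $\phi(t)$ are the potential and the current obtained from $\sigma(t)$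 in this way; equivalently $\frac{d}{dt}\log\sigma_{ij}(t)=\frac{p_i(t)-p_j(t)}{\ell_{ij}}-1$. *)

(* Defs.v *)
From mathcomp Require Import all_boot all_order all_algebra.
From mathcomp Require Import all_classical all_reals all_analysis.

Set Implicit Arguments.
Unset Strict Implicit.
Unset Printing Implicit Defensive.

Import Order.TTheory GRing.Theory Num.Theory.
Import numFieldNormedType.Exports.

Local Open Scope classical_set_scope.
Local Open Scope ring_scope.

(* A digraph on V is an arc relation [E : rel V]; "no loops" is the hypothesis
   [irreflexive E], and multiple arcs are excluded by the encoding. *)
Definition digraph_arc (V : finType) (E : rel V) : Type :=
  {e : V * V | E e.1 e.2}.

Definition arc_tail (V : finType) (E : rel V) (e : digraph_arc E) : V := (val e).1.
Definition arc_head (V : finType) (E : rel V) (e : digraph_arc E) : V := (val e).2.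

Definition digraph_connected (V : finType) (E : rel V) : Prop :=
  forall u v : V, connect (fun x y => E x y || E y x) u v.

Section Physarum.
Context {R : realType} {V : finType} {E : rel V}.
Implicit Types (b p : V -> R) (l f sigma : digraph_arc E -> R).
Implicit Types (e : digraph_arc E) (i j : V).

Definition boundary i e : R :=
  if i == arc_tail e then 1 else if i == arc_head e then -1 else 0.

Definition is_flow b f : Prop :=
  forall i, \sum_(e : digraph_arc E) boundary i e * f e = b i.

Definition positive_flows b : set (digraph_arc E -> R) :=
  [set f | is_flow b f /\ forall e, 0 <= f e].

Definition cost l f : R := \sum_(e : digraph_arc E) l e * f e.

Definition optimal_flows b l : set (digraph_arc E -> R) :=
  [set f | positive_flows b f /\
           forall g, positive_flows b g -> cost l f <= cost l g].

Definition supp f : set (digraph_arc E) := [set e | f e != 0].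

Definition optimal_arcs b l : set (digraph_arc E) :=
  \bigcup_(f in optimal_flows b l) supp f.

(* Entry (i, j) of B diag(sigma / l) B^T. *)
Definition laplacian l sigma i j : R :=
  \sum_(e : digraph_arc E) boundary i e * (sigma e / l e) * boundary j e.

(* L(sigma) p = b and min_i p_i = 0. *)
Definition is_potential b l sigma p : Prop :=
  (forall i, \sum_(j : V) laplacian l sigma i j * p j = b i) /\
  (forall i, 0 <= p i) /\ (exists i, p i = 0).

Definition current l sigma p e : R :=
  sigma e * (p (arc_tail e) - p (arc_head e)) / l e.

(* sigma and p are functions of time t : R, constrained only for t >= 0; at
   t = 0 the differential equation is understood with the right derivative.
   Only the initial state is required to be positive: for feasible b the
   positivity of sigma t for t > 0, and hence the uniqueness of p t, follow. *)
Definition physarum_solver b l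
    (sigma : R -> digraph_arc E -> R) (p : R -> V -> R) : Prop :=
  [/\ (forall e, 0 < sigma 0 e),
      (forall t : R, 0 <= t -> is_potential b l (sigma t) (p t)),
      (forall (t : R) e, 0 < t ->
         is_derive t (1 : R) (fun s : R => sigma s e)
           (current l (sigma t) (p t) e - sigma t e)) &
      (forall e,
         h^-1 * (sigma h e - sigma 0 e) @[h --> (0 : R)^'+] -->
           current l (sigma 0) (p 0) e - sigma 0 e)].

End Physarum.

(* Main.v *)
(* Put u_e(t) = l_e ln (sigma_e(t) / sigma_e(0)). As long as sigma > 0, the
   derivative of u + t l is a vector of potential drops, so
   sum_e y_e u_e(t) = - t cost(y) for every circulation y, while
   B sigma(t) = (1 - e^-t) b + e^-t B sigma(0).
   Strict complementarity provides a potential pstar whose reduced costs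
   s_e = l_e - (pstar_i - pstar_j) vanish on the optimal arcs and are positive
   elsewhere, and minimising a coercive exponential sum provides q such that
   fhat_e = sigma_e(0) exp ((q_i - q_j) / l_e) on the optimal arcs, fhat_e = 0
   elsewhere, is a flow; fhat is the limit. With
   a(t) = (1 - e^-t) fhat + e^-t sigma(0) ([interp] below) and
   c_e(t) = sigma_e(0) exp ((q_i - q_j - t s_e) / l_e) ([gibbs]), testing the invariant
   against the circulation sigma(t) - a(t) gives
     sum_e l_e (sigma_e - a_e) (ln sigma_e - ln c_e) = 0.
   Each summand is at least - l_e (a_e - c_e) (ln a_e - ln c_e), which is
   exponentially small, so each summand is also exponentially small. This keeps
   sigma away from 0 on bounded time intervals, hence positive forever, and
   forces sigma - fhat to decay exponentially. The current inherits the decay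
   because it minimises the dissipation among all flows. *)
Require Import Defs.
From mathcomp Require Import all_boot all_order all_algebra.
From mathcomp Require Import all_classical all_reals all_analysis.
From mathcomp Require Import ring lra.
Import Order.TTheory GRing.Theory Num.Theory.
Import numFieldNormedType.Exports.
Local Open Scope classical_set_scope.
Local Open Scope ring_scope.

(** * Linear alternatives over ordered fields *)

(* Bartl's induction: if adding the functional [a j] is what makes the
   implication true, then some [x'] has [a j x' = 1], and projecting along [x']
   onto the kernel of [a j] removes [a j] from the system. *)
Lemma farkas (R : realFieldType) (X : lmodType R) (J : eqType) (s : seq J)
    (a : J -> X -> R) (c : X -> R) :
  uniq s -> (forall j, scalar (a j)) -> scalar c ->
  (forall x, (forall j, j \in s -> a j x <= 0) -> c x <= 0) ->
  exists2 w : J -> R, (forall j, 0 <= w j) &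
    forall x, c x = \sum_(j <- s) w j * a j x.
Proof.
have lin0 (f : X -> R) : scalar f -> f 0 = 0.
  by move=> lf; have := lf (-1) 0 0; rewrite scaler0 addr0 mulN1r addNr.
have linZ (f : X -> R) k x : scalar f -> f (k *: x) = k * f x.
  by move=> lf; have := lf k x 0; rewrite addr0 lin0// addr0.
have linB (f : X -> R) k x y : scalar f -> f (x - k *: y) = f x - k * f y.
  by move=> lf; rewrite -scaleNr addrC lf mulNr addrC.
elim: s a c => [|j s IH] a c.
  move=> _ _ lc cle0; exists (fun=> 0) => // x; rewrite big_nil.
  apply/eqP; rewrite eq_le cle0//=.
  by rewrite -oppr_le0 -[- c x]mulN1r -linZ// cle0.
move=> /= /andP[js us] la lc cle0.
have [all_le|] := pselect (forall x, (forall i, i \in s -> a i x <= 0) -> c x <= 0).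
  have [w w0 wE] := IH a c us la lc all_le.
  exists (fun i => if i == j then 0 else w i) => [i|x]; first by case: ifP.
  rewrite big_cons eqxx mul0r add0r wE [LHS]big_seq [RHS]big_seq.
  apply: eq_bigr => i si; case: eqP => // ij; by rewrite ij (negbTE js) in si.
move=> /existsNP[x0 /not_implyP[x0le /negP]]; rewrite -ltNge => cx0.
have ajx0 : 0 < a j x0.
  rewrite ltNge; apply/negP => ajx0; move: cx0; rewrite ltNge cle0// => i.
  by rewrite inE => /orP[/eqP->//|/x0le].
pose x1 := (a j x0)^-1 *: x0.
have ajx1 : a j x1 = 1 by rewrite linZ// mulVf// gt_eqF.
have x1le i : i \in s -> a i x1 <= 0.
  by move=> si; rewrite linZ// pmulr_rle0 ?invr_gt0// x0le.
have cx1 : 0 < c x1 by rewrite linZ// mulr_gt0 ?invr_gt0.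
have lproj (f : X -> R) : scalar f -> scalar (fun x => f (x - a j x *: x1)).
  by move=> lf k x y /=; rewrite !linB// lf la; ring.
have [|w w0 wE] := IH (fun i x => a i (x - a j x *: x1))
    (fun x => c (x - a j x *: x1)) us (fun i => lproj _ (la i)) (lproj _ lc).
  move=> x xle; apply: cle0 => i; rewrite inE => /orP[/eqP->|/xle//].
  by rewrite linB// ajx1 mulr1 subrr.
(* Undoing the projection leaves this coefficient on [a j]; it is nonnegative since [c x1 > 0] and
   [a i x1 <= 0] for [i] in [s]. *)
exists (fun i => if i == j then c x1 - \sum_(i <- s) w i * a i x1 else w i).
  move=> i; case: ifP => // _; rewrite subr_ge0 (le_trans _ (ltW cx1))//.
  by rewrite big_seq sumr_le0// => k sk; rewrite mulr_ge0_le0// x1le.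
move=> x; rewrite big_cons eqxx.
have := wE x; rewrite linB// => /eqP; rewrite subr_eq => /eqP ->.
have -> : \sum_(i <- s) w i * a i (x - a j x *: x1) =
    \sum_(i <- s) w i * a i x - a j x * \sum_(i <- s) w i * a i x1.
  rewrite mulr_sumr -sumrB; apply: eq_bigr => i _; rewrite linB//; ring.
have -> : \sum_(i <- s) (if i == j then c x1 - \sum_(i0 <- s) w i0 * a i0 x1
    else w i) * a i x = \sum_(i <- s) w i * a i x.
  rewrite [LHS]big_seq [RHS]big_seq; apply: eq_bigr => i si.
  by case: eqP => // ij; rewrite ij (negbTE js) in si.
ring.
Qed.

(** Strict inequalities are achieved one at a time: if this fails at [k], Farkas writes [g k]
    through the constraints, which is a relation [y] with [y k >= 1], against the alternative.
    Summing the solutions over [k] makes all of them strict at once. *)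
Lemma motzkin_transposition (R : realFieldType) (X : lmodType R) (J : finType)
    (P : pred J) (g : J -> X -> R) :
  (forall j, scalar (g j)) ->
  (forall y : J -> R, (forall x, \sum_j y j * g j x = 0) ->
    (forall j, ~~ P j -> 0 <= y j) -> forall j, ~~ P j -> y j = 0) ->
  exists x, forall j, if P j then g j x = 0 else 0 < g j x.
Proof.
move=> lg alt.
have gD j x y : g j (x + y) = g j x + g j y.
  by have := lg j 1 x y; rewrite scale1r mul1r.
have g0 j : g j 0 = 0.
  by have /eqP := gD j 0 0; rewrite addr0 -subr_eq subrr => /eqP <-.
have single k : exists x, (forall j, if P j then g j x = 0 else 0 <= g j x) /\
    (~~ P k -> 0 < g k x).
  have [Pk|nPk] := boolP (P k).
    by exists 0; split=> // j; rewrite g0; case: ifP.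
  apply: contrapT => no_x.
  (* Equalities on [P] become two opposite inequalities; off [P] the [true] copy is the zero
     functional. *)
  pose a (j : bool * J) x :=
    (if j.1 then (if P j.2 then 1 else 0) else -1) * g j.2 x.
  have la j : scalar (a j) by move=> t x y; rewrite /a lg /=; ring.
  have [|w w0 wE] := @farkas R X _ (index_enum (bool * J)%type) a (g k)
     (index_enum_uniq _) la (lg k).
    move=> x ale; rewrite leNgt; apply/negP => gkx; apply: no_x.
    exists x; split=> // j.
    have := ale (false, j) (mem_index_enum _); rewrite /a /= mulN1r oppr_le0 => gj0.
    have := ale (true, j) (mem_index_enum _); rewrite /a /=; case: ifP => // _.
    by rewrite mul1r => gj0'; apply/eqP; rewrite eq_le gj0 gj0'.
  pose y j := (j == k)%:R + w (false, j) - (if P j then w (true, j) else 0).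
  have yE x : \sum_j y j * g j x = 0.
    have -> : \sum_j y j * g j x = g k x - \sum_j w j * a j x; last first.
      by rewrite -wE subrr.
    have -> : \sum_j w j * a j x = \sum_c \sum_i w (c, i) * a (c, i) x.
      by rewrite pair_bigA; apply: eq_bigr => -[].
    rewrite big_bool.
    have -> : g k x = \sum_j (j == k)%:R * g j x.
      rewrite (bigD1 k)//= eqxx mul1r big1 ?addr0// => h /negbTE ->.
      exact: mul0r.
    rewrite -big_split -sumrB; apply: eq_bigr => j _; rewrite /y /a /=.
    by case: (P j); ring.
  have /(_ k nPk) : forall j, ~~ P j -> y j = 0.
    apply: alt yE _ => j /negbTE nPj.
    by rewrite /y nPj subr0 addr_ge0.
  rewrite /y (negbTE nPk) eqxx subr0 => /eqP; apply/negP.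
  by rewrite gt_eqF// ltr_pwDl.
have [x xP] := choice single.
exists (\sum_k x k) => j.
have -> : g j (\sum_k x k) = \sum_k g j (x k).
  by elim/big_ind2: _ => [|u ? v ? <- <-|//]; rewrite ?g0 ?gD.
case: ifP => Pj.
  by rewrite big1// => k _; have [/(_ j)] := xP k; rewrite Pj.
rewrite (bigD1 j)//= ltr_pwDl//; first by have [_ ->] := xP j; rewrite // Pj.
by rewrite sumr_ge0// => k _; have [/(_ j)] := xP k; rewrite Pj.
Qed.

Lemma sum_option (R : nmodType) (I : finType) (F : option I -> R) :
  \sum_j F j = F None + \sum_i F (Some i).
Proof.
rewrite (bigD1 None)//=; congr (_ + _).
rewrite (reindex_omap Some id); last by case.
by apply: eq_bigl => i; rewrite eqxx.
Qed.

(** * Flows, potentials and linear programming duality *)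

Section Network.
Context {R : realType} {V : finType} {E : rel V}.
Implicit Types (b p : V -> R) (l f g y : digraph_arc E -> R).
Implicit Types (e : digraph_arc E) (i : V).

Definition potential_drop p e : R := p (arc_tail e) - p (arc_head e).

(** Homogenised reduced cost: the coordinate [None] scales [l], which turns the affine condition on
    a potential into a linear one. *)
Definition residual (l : digraph_arc E -> R) e (x : {ffun option V -> R^o}) : R :=
  x None * l e - potential_drop (fun i => x (Some i)) e.

Lemma scalar_residual l e : scalar (residual l e).
Proof.
by move=> k x y; rewrite /residual /potential_drop !ffunE /GRing.scale /=; ring.
Qed.

Hypothesis loopless : irreflexive E.

Lemma sum_boundary p e : \sum_i p i * boundary i e = potential_drop p e.
Proof.
have neq : arc_head e != arc_tail e.
  by apply/eqP => he; have := valP e; rewrite -/(arc_tail e) -/(arc_head e) he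
    loopless.
rewrite (bigD1 (arc_tail e))// (bigD1 (arc_head e))//= /boundary eqxx (negbTE neq).
rewrite eqxx big1 ?addr0 => [|i /andP[/negbTE -> /negbTE ->]]; last exact: mulr0.
by rewrite mulr1 mulrN1.
Qed.

(** Weak form of Bf = b, by summation by parts; the converse tests with vertex indicators. *)
Lemma is_flowP b f :
  is_flow b f <-> forall p, \sum_e f e * potential_drop p e = \sum_i b i * p i.
Proof.
split=> [bf p|fp i].
  under eq_bigr do rewrite -sum_boundary mulr_sumr.
  rewrite exchange_big; apply: eq_bigr => i _; rewrite -bf mulr_suml.
  by apply: eq_bigr => e _; ring.
have := fp (fun j => (j == i)%:R).
have -> : \sum_j b j * (j == i)%:R = b i.
  by rewrite (bigD1 i)//= eqxx mulr1 big1 ?addr0// => j /negbTE ->; rewrite mulr0.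
move=> <-.
apply: eq_bigr => e _; rewrite -sum_boundary (bigD1 i)//= eqxx mul1r mulrC.
by rewrite big1 ?addr0// => j /negbTE ->; rewrite mul0r.
Qed.

Lemma is_flow_lin b b' f g (k : R) : is_flow b f -> is_flow b' g ->
  is_flow (fun i => b i + k * b' i) (fun e => f e + k * g e).
Proof.
move=> bf bg i; rewrite -bf -bg mulr_sumr -big_split.
by apply: eq_bigr => e _ /=; ring.
Qed.

Lemma is_flowB b f g : is_flow b f -> is_flow b g ->
  is_flow (fun=> 0) (fun e => f e - g e).
Proof.
move=> bf bg i; under eq_bigr do rewrite mulrBr.
by rewrite sumrB [X in X - _]bf [X in _ - X]bg subrr.
Qed.

Lemma circulation_drop y p : is_flow (fun=> 0) y ->
  \sum_e y e * potential_drop p e = 0.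
Proof.
by move=> /is_flowP ->; rewrite big1// => i _; rewrite mul0r.
Qed.

(** The infimum [v] is attained by duality instead of compactness: the Farkas multipliers of the
    arcs form a flow, and evaluation at the pure scale vector writes [v] as its cost plus the
    nonnegative multiplier of [None]. *)
Lemma optimal_flows_nonempty b l : (forall e, 0 < l e) ->
  @positive_flows R V E b !=set0 -> optimal_flows b l !=set0.
Proof.
move=> l0 [f0 [bf0 f00]].
have lb : lbound (cost l @` positive_flows b) 0.
  by move=> _ [f [_ fge0] <-]; apply: sumr_ge0 => e _; rewrite mulr_ge0// ltW.
have hinf : has_inf (cost l @` positive_flows b).
  by split; [exists (cost l f0); exists f0|exists 0].
pose v := inf (cost l @` positive_flows b).
have vle f : positive_flows b f -> v <= cost l f.
  by move=> bf; apply: ge_inf; [exists 0|exists f].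
pose a (j : option (digraph_arc E)) (x : {ffun option V -> R^o}) : R :=
  if j is Some e then residual (fun e => - l e) e (- x) else x None.
pose c (x : {ffun option V -> R^o}) : R := \sum_i b i * x (Some i) + x None * v.
have aE e x : a (Some e) x =
    x None * l e + potential_drop (fun i => x (Some i)) e.
  by rewrite /a /residual /potential_drop !ffunE; ring.
have la j : scalar (a j).
  move=> k x y; case: j => [e|]; last by rewrite /= !ffunE.
  by rewrite !aE /potential_drop !ffunE /GRing.scale /=; ring.
have lc : scalar c.
  move=> k x y; rewrite /c mulrDr addrACA mulr_sumr -big_split /=.
  congr (_ + _); last by rewrite !ffunE /GRing.scale /=; ring.
  by apply: eq_bigr => i _; rewrite !ffunE /GRing.scale /=; ring.
have [|w w0 wE] := @farkas R _ _ (index_enum _) a c (index_enum_uniq _) la lc.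
  (* Weak duality bounds the pairing of [b] with [x] by [- x None] times the cost of any feasible
     flow, hence by [- x None * v]; for [x None = 0] the single flow [f0] is enough. *)
  move=> x xle.
  have x0 : x None <= 0 := xle None (mem_index_enum _).
  have xe e : potential_drop (fun i => x (Some i)) e <= - x None * l e.
    have := xle (Some e) (mem_index_enum _); rewrite aE; lra.
  have bx f : positive_flows b f ->
      \sum_i b i * x (Some i) <= - x None * cost l f.
    move=> [/is_flowP <- fge0]; rewrite /cost mulr_sumr; apply: ler_sum => e _.
    by rewrite mulrA [leRHS]mulrC ler_wpM2l.
  rewrite /c -lerBrDr sub0r -mulNr.
  have [xN0|xN0] := eqVneq (x None) 0.
    by have := bx f0 (conj bf0 f00); rewrite xN0 oppr0 !mul0r.
  have xlt0 : 0 < - x None by rewrite oppr_gt0 lt_neqAle xN0.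
  rewrite mulrC -ler_pdivrMr//; apply: lb_le_inf.
    by exists (cost l f0); exists f0.
  by move=> _ [f bf <-]; rewrite ler_pdivrMr// mulrC bx.
pose f e := w (Some e).
have bf : is_flow b f.
  apply/is_flowP => p; have := wE [ffun j => if j is Some i then p i else 0].
  rewrite /c sum_option [a None _]/= !ffunE mul0r mulr0 addr0 add0r.
  under eq_bigr do rewrite ffunE.
  move=> ->; apply: eq_bigr => e _.
  by rewrite (aE e) /f /potential_drop !ffunE mul0r add0r.
exists f; split; first by split=> // e; exact: w0.
move=> g /vle; apply: le_trans.
have := wE [ffun j => if j is Some i then 0 else 1].
rewrite /c sum_option [a None _]/= !ffunE mul1r mulr1.
rewrite big1 ?add0r => [->|i _]; last first.
  by rewrite ffunE mulr0.
suff -> : cost l f = \sum_e w (Some e) *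
    a (Some e) [ffun j => if j is Some i then 0 else 1] by rewrite lerDr.
apply: eq_bigr => e _; rewrite (aE e) /potential_drop !ffunE mul1r subrr addr0.
exact: mulrC.
Qed.
Lemma cost_lin l f g (k : R) :
  cost l (fun e => f e + k * g e) = cost l f + k * cost l g.
Proof.
by rewrite /cost mulr_sumr -big_split; apply: eq_bigr => e _ /=; ring.
Qed.

(** The optimal set is convex, so one may average, over all arcs, optimal flows that are nonzero at
    the given arc whenever it is optimal. The extra summand [f0] covers an empty arc set. *)
Lemma full_support_optimal_flow b l : @optimal_flows R V E b l !=set0 ->
  exists2 f, optimal_flows b l f & forall e, optimal_arcs b l e -> 0 < f e.
Proof.
move=> [f0 of0].
have /choice[g gP] e : exists f, optimal_flows b l f /\
    (optimal_arcs b l e -> f e != 0).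
  have [[f of_ fe]|nopt] := pselect (optimal_arcs b l e); first by exists f.
  by exists f0; split.
have gcost e : cost l (g e) = cost l f0.
  have [[pg gle] _] := gP e; have [pf0 f0le] := of0.
  by apply/eqP; rewrite eq_le gle// f0le.
pose N : R := #|{: digraph_arc E}|.+1%:R.
have N0 : 0 < N by rewrite ltr0n.
pose f e := N^-1 * (f0 e + \sum_e' g e' e).
have sumN (x : R) : N^-1 * (x + \sum_(e : digraph_arc E) x) = x.
  rewrite sumr_const -[X in X + _](mulr1n x) -mulrnDr add1n -[x *+ _]mulr_natl.
  by rewrite mulKf// gt_eqF.
have fge0 e : 0 <= f e.
  apply: mulr_ge0; first by rewrite invr_ge0 ltW.
  apply: addr_ge0; first by case: of0 => -[].
  by apply: sumr_ge0 => e' _; have [[[_ ->]]] := gP e'.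
have sum_f (w : digraph_arc E -> R) : \sum_e w e * f e =
    N^-1 * (\sum_e w e * f0 e + \sum_e' \sum_e w e * g e' e).
  rewrite exchange_big -big_split mulr_sumr; apply: eq_bigr => e _ /=.
  by rewrite -mulr_sumr /f; ring.
have cf : cost l f = cost l f0.
  rewrite -[RHS]sumN [LHS]sum_f; congr (_ * (_ + _)).
  by apply: eq_bigr => e _; rewrite -(gcost e).
exists f.
  split; last by case: of0 => _ h h' /h; rewrite cf.
  split=> // i; rewrite sum_f -[RHS]sumN.
  case: of0 => -[-> _] _.
  by congr (_ * (_ + _)); apply: eq_bigr => e _; have [[[-> _] _]] := gP e.
move=> e oe; have [[[bg gge0] _] /(_ oe) ge] := gP e.
rewrite mulr_gt0 ?invr_gt0// ltr_wpDl//; first by case: of0 => -[].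
rewrite (bigD1 e)//= ltr_pwDl ?lt_neqAle 1?eq_sym ?ge ?gge0//.
by apply: sumr_ge0 => e' _; have [[[_ ->]]] := gP e'.
Qed.

(** Motzkin's alternative would be a circulation of cost at most 0, nonnegative off the optimal
    arcs. Adding a small multiple of it to [f] keeps feasibility, so its cost is 0 and it cannot
    charge a non-optimal arc. *)
Lemma strict_complementarity b l f : optimal_flows b l f ->
  (forall e, optimal_arcs b l e -> 0 < f e) ->
  exists p, forall e, (optimal_arcs b l e -> potential_drop p e = l e) /\
    (~ optimal_arcs b l e -> potential_drop p e < l e).
Proof.
move=> [[bf fge0] fmin] fpos.
pose P (j : option (digraph_arc E)) :=
  if j is Some e then `[< optimal_arcs b l e >] else false.
pose g (j : option (digraph_arc E)) (x : {ffun option V -> R^o}) : R :=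
  if j is Some e then residual l e x else x None.
have lg j : scalar (g j).
  by case: j => [e|]; [exact: scalar_residual|move=> k x y; rewrite /g !ffunE].
have [y yE y0|x xP] := @motzkin_transposition R _ _ P g lg.
  pose y' e := y (Some e).
  have circ : is_flow (fun=> 0) y'.
    apply/is_flowP => p; have := yE [ffun j => if j is Some i then p i else 0].
    rewrite sum_option /g ffunE mulr0 add0r => yp.
    rewrite [RHS]big1 => [|i _]; last by rewrite mul0r.
    apply/eqP; rewrite -oppr_eq0 -sumrN -[X in _ == X]yp; apply/eqP.
    by apply: eq_bigr => e _; rewrite /residual /potential_drop !ffunE /y'; ring.
  have costy : y None + cost l y' = 0.
    rewrite -[RHS](yE [ffun j => if j is Some i then 0 else 1]) sum_option /g ffunE.
    rewrite mulr1; congr (_ + _); apply: eq_bigr => e _.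
    by rewrite /residual /potential_drop !ffunE /y'; ring.
  have foff e : ~ optimal_arcs b l e -> f e = 0.
    by move=> noe; apply: contra_notP noe => /eqP fe; exists f.
  pose S := \sum_e `|y' e| / f e.
  have Sge0 : 0 <= S by apply: sumr_ge0 => e _; rewrite divr_ge0.
  (* Small enough that [eps * |y' e| <= f e] at every optimal arc. *)
  pose eps := (S + 1)^-1.
  have eps0 : 0 < eps by rewrite invr_gt0; lra.
  pose h e := f e + eps * y' e.
  have hge0 e : 0 <= h e.
    rewrite /h; have [oe|noe] := pselect (optimal_arcs b l e); last first.
      rewrite foff// add0r; apply: mulr_ge0; first exact: ltW.
      by apply: y0; apply/asboolPn.
    have : `|y' e| / f e <= S + 1.
      rewrite /S (bigD1 e)//= -addrA lerDl addr_ge0//.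
      by apply: sumr_ge0 => e' _; rewrite divr_ge0.
    rewrite ler_pdivrMr ?fpos// -ler_pdivrMl; last by lra.
    by have := ler_norm (- (eps * y' e)); rewrite normrN normrM gtr0_norm//
      -/eps; lra.
  have bh : is_flow b h.
    move=> i; rewrite (is_flow_lin _ _ _ _ eps bf circ); lra.
  have ch : cost l h = cost l f + eps * cost l y' by exact: cost_lin.
  have cy : 0 <= cost l y'.
    by have := fmin h (conj bh hge0); rewrite ch lerDl pmulr_rge0.
  have yN : 0 <= y None by apply: y0.
  have cy0 : cost l y' = 0 by lra.
  case=> [e /= /asboolPn noe|_]; last by lra.
  (* A nonzero [y' e] off the optimal arcs would put [e] in the support of the optimal flow [h]. *)
  have oh : optimal_flows b l h.
    by split=> // k bk; rewrite ch cy0 mulr0 addr0; exact: fmin.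
  have /eqP : h e = 0.
    by apply: contra_notP noe => /eqP he; exists h.
  by rewrite /h foff// add0r mulf_eq0 gt_eqF//= => /eqP.
have x0 : 0 < x None := xP None.
exists (fun i => x (Some i) / x None) => e; have /= := xP (Some e).
have -> : potential_drop (fun i => x (Some i) / x None) e =
    l e - g (Some e) x / x None.
  rewrite /= /residual /potential_drop; field; lra.
by case: asboolP => // oe /=; [move=> ->; rewrite mul0r subr0; split
  |move=> gt; split=> // _; rewrite gtrBl divr_gt0].
Qed.
End Network.

(** * Flows of exponential form on a given arc set *)

Lemma is_derive_bigsum (R : realType) (I : finType) (F : I -> R -> R)
    (dF : I -> R) (x : R) : (forall i, is_derive x (1 : R) (F i) (dF i)) ->
  is_derive x (1 : R) (fun t => \sum_i F i t) (\sum_i dF i).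
Proof.
move=> dF_; have -> : (fun t => \sum_i F i t) = \sum_i F i.
  by apply/funext => t; rewrite fct_sumE.
by elim/big_ind2: _ => // [|? ? ? ? ? ?]; [exact: is_derive_cst|exact: is_deriveD].
Qed.

(** For negative [x] the linear term suffices; otherwise the exponential lies above its tangent at
    [ln K], with [K] chosen so that the tangent has slope [2 * f] in [x]. *)
Lemma expR_affine_coercive (R : realType) (l c f : R) :
  0 < l -> 0 < c -> 0 < f -> exists C, forall x,
    f * `|x| - C <= l * c * expR (x / l) - f * x.
Proof.
move=> l0 c0 f0; pose K := 2 * f / c.
have K0 : 0 < K by rewrite /K divr_gt0// mulr_gt0.
exists (`|2 * f * l * (ln K - 1)|) => x.
have := expR_ge1Dx (x / l - ln K); rewrite expRB lnK ?posrE// ler_pdivlMr// => h.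
have : l * c * ((1 + (x / l - ln K)) * K) <= l * c * expR (x / l).
  by rewrite ler_wpM2l// mulr_ge0// ltW.
have -> : l * c * ((1 + (x / l - ln K)) * K) = 2 * f * x - 2 * f * l * (ln K - 1).
  by rewrite /K; field; lra.
have e0 : 0 <= l * c * expR (x / l) by rewrite !mulr_ge0 ?expR_ge0// ltW.
have := ler_norm (2 * f * l * (ln K - 1)).
have := normr_ge0 (2 * f * l * (ln K - 1)).
by case: (ger0P x) => x0; nra.
Qed.

(* First-order condition at a minimiser of
   sum_e (l_e c_e exp ((q D)_e / l_e) - f_e (q D)_e), which is coercive in q D
   only; replacing q by (q D) D^+ with the partial inverse D^+ of D confines q
   to a compact box. *)
Lemma exp_family_matching (R : realType) (n m : nat) (D : 'M[R]_(n, m))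
    (l c f : 'I_m -> R) :
  (forall e, 0 < l e) -> (forall e, 0 < c e) -> (forall e, 0 < f e) ->
  exists q : 'rV[R]_n, forall z : 'rV[R]_n,
    \sum_e (c e * expR ((q *m D) 0 e / l e) - f e) * (z *m D) 0 e = 0.
Proof.
move=> l0 c0 f0.
pose h e x := l e * c e * expR (x / l e) - f e * x.
have dh e x : is_derive x (1 : R) (h e) (c e * expR (x / l e) - f e).
  rewrite /h; apply: is_derive_eq.
  rewrite /GRing.scale /=; field.
  by rewrite gt_eqF.
pose H (q : 'rV[R]_n) := \sum_e h e ((q *m D) 0 e).
have /choice[C hC] e :=
  expR_affine_coercive R (l e) (c e) (f e) (l0 e) (c0 e) (f0 e).
pose S := H 0 + \sum_e `|C e|.
pose M := \sum_e `|S| / f e.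
have M0 : 0 <= M by apply: sumr_ge0 => e _; rewrite divr_ge0// ltW.
have cmul e : continuous (fun q : 'rV[R]_n => (q *m D) 0 e).
  have -> : (fun q : 'rV[R]_n => (q *m D) 0 e) = fun q => \sum_i q 0 i * D i e.
    by apply/funext => q; rewrite mxE.
  apply: (continuous_big add_continuous) => i _ q.
  by apply: continuousM; [exact: coord_continuous|exact: cst_continuous].
have cH : continuous H.
  apply: (continuous_big add_continuous) => e _ q.
  have ch : continuous (h e).
    move=> x; apply/differentiable_continuous/derivable1_diffP.
    exact: ex_derive.
  exact: (@continuous_comp _ _ _ (fun q : 'rV[R]_n => (q *m D) 0 e) (h e) q
    (cmul e q) (ch _)).
(* Coercivity bounds all coordinates of [q *m D] on this sublevel set by one constant. *)
have bound q e : H q <= H 0 -> `|(q *m D) 0 e| <= M.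
  move=> qH; have : f e * `|(q *m D) 0 e| <= S.
    have hS : \sum_e (f e * `|(q *m D) 0 e| - `|C e|) <= H 0.
      apply: le_trans qH; apply: ler_sum => i _; apply: le_trans (hC i _).
      by rewrite lerD2l lerN2 ler_norm.
    move: hS; rewrite sumrB lerBlDr; apply: le_trans.
    rewrite (bigD1 e)//= lerDl; apply: sumr_ge0 => i _.
    by rewrite mulr_ge0// ltW.
  rewrite mulrC -ler_pdivlMr// => /le_trans; apply.
  rewrite /M (bigD1 e)//= -[leLHS]addr0; apply: lerD.
    by rewrite ler_pM2r ?invr_gt0// ler_norm.
  by apply: sumr_ge0 => i _; rewrite divr_ge0// ltW.
pose M' := M * \sum_e \sum_i `|(pinvmx D) e i|.
have M'0 : 0 <= M' by rewrite mulr_ge0// sumr_ge0// => e _; rewrite sumr_ge0.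
pose A := [set q : 'rV[R]_n | forall i, q 0 i \in `[- M', M']].
have cA : compact A.
  apply: (@rV_compact R n (fun=> `[- M', M']%classic)) => i.
  exact: segment_compact.
have A0 : A !=set0.
  by exists 0 => i; rewrite mxE in_itv /= oppr_le0 M'0.
have [q qA qmin] := EVT_min_rV A0 cA (continuous_subspaceT cH).
have gmin z : H q <= H z.
  have [Hz|/ltW Hz] := leP (H z) (H 0); last first.
    apply: le_trans Hz; apply: qmin; rewrite inE => i.
    by rewrite mxE in_itv /= oppr_le0 M'0.
  pose z' := z *m D *m pinvmx D.
  have -> : H z = H z' by rewrite /H /z' mulmxKpV// submxMl.
  apply: qmin; rewrite inE => i; rewrite in_itv /= -ler_norml mxE.
  apply: le_trans (ler_norm_sum _ _ _) _; rewrite /M' mulr_sumr.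
  apply: ler_sum => e _.
  rewrite normrM; apply: ler_pM => //; first exact: bound.
  by rewrite (bigD1 i)//= lerDl sumr_ge0.
exists q => z.
pose y e := (q *m D) 0 e.
(* Along the line [q + t *: z] the function is minimal at [t = 0], so its derivative there, which is
   the required sum, vanishes. *)
pose phi t := \sum_e h e (y e + t * (z *m D) 0 e).
have phiE t : phi t = H (q + t *: z).
  apply: eq_bigr => e _; congr (h e _).
  by rewrite mulmxDl -scalemxAl [RHS]mxE; congr (_ + _); rewrite [RHS]mxE.
pose dphi t :=
  \sum_e (c e * expR ((y e + t * (z *m D) 0 e) / l e) - f e) * (z *m D) 0 e.
have dphiP t : is_derive t (1 : R) phi (dphi t).
  apply: is_derive_bigsum => e.
  apply: (@is_derive1_comp R (h e) (fun t => y e + t * (z *m D) 0 e)).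
  by apply: is_derive_eq; rewrite add0r mul1r scaler0 add0r /GRing.scale /= mulr1.
have d0 : is_derive (0 : R) 1 phi 0.
  apply: (@derive1_at_min R phi (-1) 1) => [|u _||u _]; first by lra.
  - by have [] := dphiP u.
  - by rewrite in_itv /=; lra.
  - by rewrite !phiE scale0r addr0.
have := @derive_val _ _ _ _ _ _ _ (dphiP 0).
rewrite (@derive_val _ _ _ _ _ _ _ d0) => /esym; apply: etrans; rewrite /dphi.
by apply: eq_bigr => e _; rewrite mul0r addr0.
Qed.

(** With [D] the boundary matrix restricted to [O], the first-order condition says that the
    exponential vector and [f] pair equally with every potential drop, so both are flows for [b]. *)
Lemma entropic_center (R : realType) (V : finType) (E : rel V)
    (loopless : irreflexive E) (b : V -> R) (l f c : digraph_arc E -> R)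
    (O : set (digraph_arc E)) :
  (forall e, 0 < l e) -> (forall e, 0 < c e) -> is_flow b f ->
  (forall e, O e -> 0 < f e) -> (forall e, ~ O e -> f e = 0) ->
  exists q : V -> R, is_flow b (fun e =>
    if `[< O e >] then c e * expR (potential_drop q e / l e) else 0).
Proof.
move=> l0 c0 bf fO fnO.
pose D : 'M[R]_(#|V|, #|{: digraph_arc E}|) := \matrix_(i, e)
  if `[< O (enum_val e) >] then boundary (enum_val i) (enum_val e) else 0.
pose vec (p : V -> R) : 'rV[R]_#|V| := \row_i p (enum_val i).
have vecD p e : (vec p *m D) 0 e =
    if `[< O (enum_val e) >] then potential_drop p (enum_val e) else 0.
  rewrite mxE; under eq_bigr do rewrite !mxE.
  case: ifP => _; last by rewrite big1// => i _; rewrite mulr0.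
  rewrite -sum_boundary// [RHS](reindex (@enum_val V V))//=.
  exact/onW_bij/enum_val_bij.
(* Off [O] the columns of [D] vanish; the value 1 there supplies the positivity that the matching
   requires. *)
have [|||q qP] := @exp_family_matching R _ _ D (fun e => l (enum_val e))
    (fun e => c (enum_val e))
    (fun e => if `[< O (enum_val e) >] then f (enum_val e) else 1).
- by move=> e; exact: l0.
- by move=> e; exact: c0.
- by move=> e; case: asboolP => // /fO.
pose q' i := q 0 (enum_rank i).
have qE : q = vec q' by apply/rowP => i; rewrite mxE /q' enum_valK.
exists q'; apply/is_flowP => // p; rewrite -(proj1 (is_flowP loopless b f) bf).
apply/eqP; rewrite -subr_eq0 -sumrB; apply/eqP.
rewrite -[RHS](qP (vec p))
  (reindex (fun e : 'I_#|{: digraph_arc E}| => enum_val e))/=; last first.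
  exact/onW_bij/enum_val_bij.
apply: eq_bigr => e _; rewrite qE !vecD.
by case: asboolP => [_|/fnO ->]; ring.
Qed.

(** * Scalar inequalities for logarithmic gaps *)

Section LogInequalities.
Context {R : realType}.
Implicit Types x a c m g : R.

Lemma ln_diff_ge x a : 0 < x -> 0 < a -> 1 - a / x <= ln x - ln a.
Proof.
move=> x0 a0; have := expR_ge1Dx (ln a - ln x).
by rewrite expRB !lnK ?posrE//; lra.
Qed.

Lemma ler_ln_pos x a : 0 < x -> x <= a -> ln x <= ln a.
Proof. by move=> x0 xa; rewrite ler_ln ?posrE//; exact: lt_le_trans xa. Qed.

Lemma log_gap_ge0 a c : 0 < a -> 0 < c -> 0 <= (a - c) * (ln a - ln c).
Proof.
move=> a0 c0; case: (leP a c) => h.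
  by have := ler_ln_pos _ _ a0 h; nra.
by have := ler_ln_pos _ _ c0 (ltW h); nra.
Qed.

(** The right-hand side is negative only for [x] strictly between [a] and [c], where both factors
    are dominated by those of the left-hand side. *)
Lemma log_gap_lower x a c : 0 < x -> 0 < a -> 0 < c ->
  - ((a - c) * (ln a - ln c)) <= (x - a) * (ln x - ln c).
Proof.
move=> x0 a0 c0.
have xa := log_gap_ge0 _ _ x0 a0; have xc := log_gap_ge0 _ _ x0 c0.
have [ac|/ltW ac] := leP a c; have [h|/ltW h] := leP x c.
- by have := ler_ln_pos _ _ a0 ac; nra.
- by have := ler_ln_pos _ _ a0 (le_trans ac h); nra.
- by have := ler_ln_pos _ _ x0 (le_trans h ac); nra.
- by have := ler_ln_pos _ _ c0 ac; nra.
Qed.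

(** Between [a] and [c] the distance to [a] is at most [|a - c|]. Outside, with [M] the nearer
    endpoint, the gap dominates [(x - M)^2 / max(x, M)], so [x] is close to [M]. *)
Lemma log_gap_close x a c m g : 0 < x -> 0 < a <= m -> 0 < c <= m -> 0 <= g ->
  (x - a) * (ln x - ln c) <= g ->
  (x - a) ^+ 2 <= 2 * (a - c) ^+ 2 + 2 * g ^+ 2 + 4 * g * m.
Proof.
move=> x0 /andP[a0 am] /andP[c0 cm] g0 gap.
have m0 : 0 < m by lra.
have gm : 0 <= g * m by rewrite mulr_ge0// ltW.
have lnax := ln_diff_ge _ _ x0 a0.
have lncx := ln_diff_ge _ _ x0 c0.
have big M : a <= M -> c <= M -> M <= m -> M <= x ->
    (x - M) ^+ 2 <= g ^+ 2 + 2 * g * m.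
  move=> aM cM Mm Mx.
  have M0 : 0 < M by lra.
  have h := ln_diff_ge _ _ x0 M0.
  have hc := ler_ln_pos _ _ c0 cM.
  have hM : (x - M) * (1 - M / x) <= g.
    apply: le_trans gap; apply: ler_pM; [lra| |lra|lra].
    by rewrite subr_ge0 ler_pdivrMr// mul1r.
  have : (x - M) ^+ 2 <= g * x.
    have E : (x - M) ^+ 2 / x = (x - M) * (1 - M / x) by field; lra.
    by rewrite -ler_pdivrMr// E.
  (* [x] has no a priori upper bound: write [g * x] as [g * M + g * (x - M)] and absorb the last
     product by Young's inequality. *)
  have := sqr_ge0 (g - (x - M)).
  nra.
have small n : n <= a -> n <= c -> 0 < n -> n <= m -> x <= n ->
    (n - x) ^+ 2 <= g * m.
  move=> na nc n0 nm xn.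
  have h := ln_diff_ge _ _ n0 x0.
  have hc := ler_ln_pos _ _ n0 nc.
  have hx := ler_ln_pos _ _ x0 xn.
  have hn : (n - x) * (1 - x / n) <= g.
    apply: le_trans gap; rewrite -[leRHS]mulrNN; apply: ler_pM; [lra| |lra|lra].
    by rewrite subr_ge0 ler_pdivrMr// mul1r.
  have : (n - x) ^+ 2 <= g * n.
    have E : (n - x) ^+ 2 / n = (n - x) * (1 - x / n) by field; lra.
    by rewrite -ler_pdivrMr// E.
  nra.
have g2 := sqr_ge0 g.
have par := sqr_ge0 (x - c - (c - a)).
have ac2 := sqr_ge0 (a - c).
have [ac|/ltW ac] := leP a c.
  have [xc|/ltW xc] := leP c x.
    by have := big c ac (lexx c) cm xc; nra.
  have [xa|/ltW xa] := leP x a.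
    by have := small a (lexx a) ac a0 am xa; nra.
  have : (x - a) ^+ 2 <= (a - c) ^+ 2 by rewrite -[leRHS]sqrrN lerXn2r ?nnegrE; lra.
  nra.
have [xa|/ltW xa] := leP a x.
  by have := big a (lexx a) ac am xa; nra.
have [xc|/ltW xc] := leP x c.
  by have := small c ac (lexx c) c0 cm xc; nra.
have : (x - a) ^+ 2 <= (a - c) ^+ 2 by rewrite -sqrrN lerXn2r ?nnegrE; lra.
nra.
Qed.

(** If [x < a0 / 2], then [a - x] exceeds [a0 / 2], and the gap bounds [k - ln x] by
    [2 * g / a0]. *)
Lemma log_gap_away0 x a c g a0 k : 0 < x -> 0 < a0 <= a -> k <= ln c -> 0 <= g ->
  (x - a) * (ln x - ln c) <= g ->
  Num.min (a0 / 2) (expR (k - 2 * g / a0)) <= x.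
Proof.
move=> x0 /andP[a00 a0a] kc g0 gap; rewrite ge_min -implyNb -ltNge.
apply/implyP => xa; rewrite -[leRHS]lnK ?posrE// ler_expR.
have [h|h] := leP k (ln x).
  by have : 0 <= 2 * g / a0 by [apply: divr_ge0; lra]; lra.
have : a0 / 2 * (k - ln x) <= g by nra.
rewrite mulrC -ler_pdivlMr ?divr_gt0//.
have -> : g / (a0 / 2) = 2 * g / a0 by field; lra.
lra.
Qed.
End LogInequalities.

(** * Calculus of exponentially decaying functions *)

Section ExponentialDecay.
Context {R : realType}.
Implicit Types (f g h : R -> R) (k t C T : R).

(** Constant, rate and threshold are existential, so the closure properties below need no
    bookkeeping of rates. *)
Definition exp_decay h : Prop := exists C k T,
  [/\ 0 <= C, 0 < k, 0 <= T & forall t, T <= t -> `|h t| <= C * expR (- (k * t))].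

Lemma exp_decay_expR k : 0 < k -> exp_decay (fun t => expR (- (k * t))).
Proof.
move=> k0; exists 1, k, 0; split => // t _.
by rewrite mul1r ger0_norm ?expR_ge0.
Qed.

Lemma exp_decay_le T g h : exp_decay g ->
  (forall t, T <= t -> `|h t| <= g t) -> exp_decay h.
Proof.
move=> [C [k [T' [C0 k0 T'0 gC]]]] hg.
exists C, k, (Num.max T T'); split => //; first by rewrite le_max T'0 orbT.
move=> t; rewrite ge_max => /andP[/hg ht /gC gt].
exact/(le_trans ht)/(le_trans _ gt)/ler_norm.
Qed.

Lemma exp_decayD f g : exp_decay f -> exp_decay g ->
  exp_decay (fun t => f t + g t).
Proof.
move=> [C [k [T [C0 k0 T0 fC]]]] [C' [k' [T' [C'0 k'0 T'0 gC]]]].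
exists (C + C'), (Num.min k k'), (Num.max T T'); split.
- exact: addr_ge0.
- by rewrite lt_min k0.
- by rewrite le_max T0.
move=> t; rewrite ge_max => /andP[Tt T't]; have t0 : 0 <= t by lra.
rewrite mulrDl; apply: le_trans (ler_normD _ _) _; apply: lerD.
  apply: le_trans (fC _ Tt) _; rewrite ler_wpM2l// ler_expR lerN2 ler_wpM2r//.
  by rewrite ge_min lexx.
apply: le_trans (gC _ T't) _; rewrite ler_wpM2l// ler_expR lerN2 ler_wpM2r//.
by rewrite ge_min lexx orbT.
Qed.

Lemma exp_decayZ (c : R) f : exp_decay f -> exp_decay (fun t => c * f t).
Proof.
move=> [C [k [T [C0 k0 T0 fC]]]]; exists (`|c| * C), k, T; split => //.
  by rewrite mulr_ge0.
by move=> t /fC ft; rewrite normrM -mulrA ler_wpM2l.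
Qed.

Lemma exp_decay0 : exp_decay (fun=> 0).
Proof.
exists 0, 1, 0; split => // t _.
by rewrite normr0 mul0r.
Qed.

Lemma exp_decay_sum (I : finType) (F : I -> R -> R) :
  (forall i, exp_decay (F i)) -> exp_decay (fun t => \sum_i F i t).
Proof.
move=> dF; elim: (index_enum I) => [|i s IH].
  apply: (exp_decay_le 0 _ _ exp_decay0) => t _.
  by rewrite big_nil normr0.
have := exp_decayD _ _ (dF i) IH; congr exp_decay.
by apply/funext => t; rewrite big_cons.
Qed.

Lemma exp_decay_norm f : exp_decay f -> exp_decay (fun t => `|f t|).
Proof.
move=> [C [k [T [C0 k0 T0 fC]]]]; exists C, k, T; split => // t /fC.
by rewrite normr_id.
Qed.

Lemma exp_decayX f n : exp_decay f -> exp_decay (fun t => f t ^+ n.+1).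
Proof.
move=> [C [k [T [C0 k0 T0 fC]]]].
exists (C ^+ n.+1), k, T; split => //; first exact: exprn_ge0.
move=> t Tt; have t0 : 0 <= t := le_trans T0 Tt.
rewrite normrX; apply: le_trans (_ : (C * expR (- (k * t))) ^+ n.+1 <= _).
  by rewrite lerXn2r ?nnegrE ?mulr_ge0 ?expR_ge0// fC.
rewrite exprMn ler_wpM2l ?exprn_ge0//.
rewrite exprS ler_piMr ?expR_ge0// exprn_ile1 ?expR_ge0//.
by rewrite expR_le1 oppr_le0 mulr_ge0// ltW.
Qed.

Lemma exp_decay_sqrt f : exp_decay (fun t => f t ^+ 2) -> exp_decay f.
Proof.
(* The constant works because [C <= (C + 1)^2]. *)
move=> [C [k [T [C0 k0 T0 fC]]]]; exists (C + 1), (k / 2), T; split => //; try lra.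
move=> t /fC; rewrite ger0_norm ?sqr_ge0// => ft.
rewrite -(@ler_pXn2r _ 2)// ?nnegrE ?mulr_ge0 ?expR_ge0 ?addr_ge0//.
rewrite real_normK ?num_real//; apply: le_trans ft _.
rewrite exprMn -expRM_natr; have -> : - (k / 2 * t) * 2 = - (k * t) by field.
by rewrite ler_wpM2r ?expR_ge0//; nra.
Qed.

(** Half of the rate pays for the factor: [t * expR (- (k / 2 * t)) <= 2 / k]. *)
Lemma exp_decayMt f : exp_decay f -> exp_decay (fun t => t * f t).
Proof.
move=> [C [k [T [C0 k0 T0 fC]]]]; exists (2 / k * C), (k / 2), T; split => //.
- by rewrite mulr_ge0// divr_ge0// ltW.
- by rewrite divr_gt0.
move=> t Tt; have t0 : 0 <= t := le_trans T0 Tt.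
rewrite normrM ger0_norm//.
apply: le_trans (_ : t * (C * expR (- (k * t))) <= _).
  by rewrite ler_wpM2l ?fC.
have -> : expR (- (k * t)) = expR (- (k / 2 * t)) * expR (- (k / 2 * t)).
  by rewrite -expRD; congr expR; field.
have e0 := expR_gt0 (- (k / 2 * t)).
have : t * expR (- (k / 2 * t)) <= 2 / k.
  rewrite expRN ler_pdivrMr ?expR_gt0// -ler_pdivrMl ?divr_gt0// invf_div.
  by have := expR_ge1Dx (k / 2 * t); lra.
move=> h; have -> : t * (C * (expR (- (k / 2 * t)) * expR (- (k / 2 * t)))) =
  (t * expR (- (k / 2 * t))) * (C * expR (- (k / 2 * t))) by ring.
by rewrite -[leRHS]mulrA ler_wpM2r// mulr_ge0// ltW.
Qed.

(** Half of the rate absorbs the constant once [k / 2 * t >= C], which gives the constant-free form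
    of the final bound. *)
Lemma exp_decay_rate f : exp_decay f ->
  exists a T, [/\ 0 < a, 0 <= T & forall t, T <= t -> `|f t| <= expR (- (a * t))].
Proof.
move=> [C [k [T [C0 k0 T0 fC]]]]; exists (k / 2), (Num.max T (2 * C / k)); split.
- by rewrite divr_gt0.
- by rewrite le_max T0.
move=> t; rewrite ge_max => /andP[/fC ft].
rewrite ler_pdivrMr// => Ct; apply: le_trans ft _.
have -> : expR (- (k * t)) = expR (- (k / 2 * t)) * expR (- (k / 2 * t)).
  by rewrite -expRD; congr expR; field.
rewrite mulrA ler_piMl ?expR_ge0//.
rewrite expRN ler_pdivrMr ?expR_gt0// mul1r.
by have := expR_ge1Dx (k / 2 * t); lra.
Qed.

Lemma exp_decay_lt f eps : exp_decay f -> 0 < eps ->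
  exists2 T, 0 <= T & forall t, T <= t -> `|f t| < eps.
Proof.
move=> /exp_decay_rate[a [T [a0 T0 fT]]] e0.
exists (Num.max T (1 / (a * eps))); first by rewrite le_max T0.
move=> t; rewrite ge_max => /andP[/fT ft].
rewrite ler_pdivrMr ?mulr_gt0// => h; apply: le_lt_trans ft _.
rewrite expRN -[ltRHS]invrK ltf_pV2 ?posrE ?expR_gt0 ?invr_gt0//.
have := expR_ge1Dx (a * t); apply: lt_le_trans.
rewrite -[ltLHS]mul1r ltr_pdivrMr//; nra.
Qed.
End ExponentialDecay.

(** * Consequences of the entropic balance, independent of the dynamics *)

Section EntropicBalance.
Context {R : realType} {A : finType} (l sigma0 fhat s dq : A -> R).
Implicit Types (t T : R) (x : A -> R) (e : A).

Definition interp t e : R := (1 - expR (- t)) * fhat e + expR (- t) * sigma0 e.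

Definition gibbs t e : R := sigma0 e * expR ((dq e - t * s e) / l e).

(** The [l]-weighted symmetrised relative entropy of [interp] and [gibbs]. *)
Definition entropic_gap t : R :=
  \sum_e l e * ((interp t e - gibbs t e) * (ln (interp t e) - ln (gibbs t e))).

Definition balanced t x : Prop :=
  \sum_e l e * ((x e - interp t e) * (ln (x e) - ln (gibbs t e))) = 0.

Hypothesis l_gt0 : forall e, 0 < l e.
Hypothesis sigma0_gt0 : forall e, 0 < sigma0 e.
Hypothesis s_ge0 : forall e, 0 <= s e.
Hypothesis fhat_gt0 : forall e, s e = 0 -> fhat e = sigma0 e * expR (dq e / l e).
Hypothesis fhat_eq0 : forall e, 0 < s e -> fhat e = 0.

Let fhat_ge0 e : 0 <= fhat e.
Proof.
have := s_ge0 e; rewrite le_eqVlt => /orP[/eqP/esym/fhat_gt0 ->|/fhat_eq0 -> //].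
by rewrite mulr_ge0 ?expR_ge0// ltW.
Qed.

Let bound e := fhat e + sigma0 e + sigma0 e * expR (dq e / l e).

Lemma interp_bounds t e : 0 <= t ->
  expR (- t) * sigma0 e <= interp t e <= fhat e + sigma0 e.
Proof.
move=> t0; have := fhat_ge0 e; have := sigma0_gt0 e; rewrite /interp.
have : expR (- t) <= 1 by rewrite expR_le1 oppr_le0.
by have := expR_gt0 (- t); nra.
Qed.

Lemma interp_gt0 t e : 0 <= t -> 0 < interp t e.
Proof.
move=> t0; have /andP[h _] := interp_bounds t e t0.
by apply: lt_le_trans h; rewrite mulr_gt0 ?expR_gt0.
Qed.

Lemma gibbs_gt0 t e : 0 < gibbs t e.
Proof. by rewrite mulr_gt0 ?expR_gt0. Qed.

Lemma ln_gibbs t e : ln (gibbs t e) = ln (sigma0 e) + (dq e - t * s e) / l e.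
Proof. by rewrite lnM ?posrE ?expR_gt0// expRK. Qed.

Let interp_le t e : 0 <= t -> interp t e <= bound e.
Proof.
move=> t0; have /andP[_ /le_trans] := interp_bounds t e t0; apply.
by rewrite lerDl mulr_ge0 ?expR_ge0// ltW.
Qed.

Let gibbs_le t e : 0 <= t -> gibbs t e <= bound e.
Proof.
move=> t0; apply: le_trans (_ : sigma0 e * expR (dq e / l e) <= _); last first.
  by rewrite lerDr addr_ge0// ltW.
rewrite ler_wpM2l//; first exact: ltW.
rewrite ler_expR; apply: ler_wpM2r; first by rewrite invr_ge0 ltW.
by rewrite gerBl mulr_ge0.
Qed.

Let slope e :=
  `|ln (fhat e + sigma0 e) - ln (sigma0 e)| + `|dq e / l e| + s e / l e + 1.

(** [ln (interp t e)] lies between [ln (sigma0 e) - t] and a constant, and [ln (gibbs t e)] is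
    affine in [t]. Linear growth is harmless against exponential decay. *)
Lemma ln_interp_gibbs t e : 0 <= t ->
  `|ln (interp t e) - ln (gibbs t e)| <= slope e * (1 + t).
Proof.
move=> t0; have /andP[lo hi] := interp_bounds t e t0.
have := ler_ln_pos _ _ (interp_gt0 t e t0) hi.
have := ler_ln_pos _ _ (mulr_gt0 (expR_gt0 (- t)) (sigma0_gt0 e)) lo.
rewrite lnM ?posrE ?expR_gt0// expRK ln_gibbs.
have -> : (dq e - t * s e) / l e = dq e / l e - t * (s e / l e) by ring.
rewrite /slope; have : 0 <= s e / l e by rewrite divr_ge0// ltW.
move: (s e / l e) (dq e / l e) (ln (interp t e)) (ln (sigma0 e)) => u v w z.
move: (ln (fhat e + sigma0 e)) => y u0 h1 h2.
have := ler_norm (y - z); have := ler_norm v; have := ler_norm (- v).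
rewrite normrN; move: `|y - z| (normr_ge0 (y - z)) `|v| (normr_ge0 v).
by move=> n1 n10 n2 n20 *; rewrite ler_norml; nra.
Qed.

(** On tight arcs [gibbs] is constantly [fhat] and the difference is a multiple of [expR (- t)]; on
    slack arcs [fhat] is 0 and both terms decay. *)
Lemma exp_decay_interp_gibbs e : exp_decay (fun t => interp t e - gibbs t e).
Proof.
have d1 := @exp_decay_expR R 1 ltr01.
have := s_ge0 e; rewrite le_eqVlt => /orP[/eqP/esym se0|se0].
  have := exp_decayZ (sigma0 e - fhat e) _ d1; congr exp_decay.
  apply/funext => t; rewrite /interp /gibbs se0 mulr0 subr0 -fhat_gt0// mul1r.
  by ring.
have d2 := @exp_decay_expR R (s e / l e) (divr_gt0 se0 (l_gt0 e)).
have := exp_decayD _ _ (exp_decayZ (sigma0 e) _ d1)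
  (exp_decayZ (- (sigma0 e * expR (dq e / l e))) _ d2); congr exp_decay.
apply/funext => t; rewrite /interp /gibbs fhat_eq0// mulr0 add0r mul1r.
have -> : (dq e - t * s e) / l e = dq e / l e + - (s e / l e * t).
  by field; rewrite gt_eqF.
by rewrite expRD; ring.
Qed.

Lemma exp_decay_entropic_gap : exp_decay entropic_gap.
Proof.
apply: exp_decay_sum => e; have d := exp_decay_norm _ (exp_decay_interp_gibbs e).
apply: (exp_decay_le 0 _ _ (exp_decayZ (l e * slope e) _
  (exp_decayD _ _ d (exp_decayMt _ d)))) => t t0.
have := ln_interp_gibbs t e t0; rewrite !normrM gtr0_norm//.
move: `|ln _ - _| `|interp t e - _| (normr_ge0 (interp t e - gibbs t e)).
move=> u v v0 h.
rewrite -mulrA ler_wpM2l//; first exact: ltW.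
by have := ler_wpM2l v0 h; lra.
Qed.

Lemma entropic_gap_ge0 t : 0 <= t -> 0 <= entropic_gap t.
Proof.
move=> t0; apply: sumr_ge0 => e _; rewrite mulr_ge0//; first exact: ltW.
by rewrite log_gap_ge0 ?interp_gt0 ?gibbs_gt0.
Qed.

Lemma entropic_gap_bounded T :
  exists M, forall t, 0 <= t <= T -> entropic_gap t <= M.
Proof.
exists (\sum_e l e * (bound e * (slope e * (1 + T)))) => t /andP[t0 tT].
apply: ler_sum => e _; rewrite ler_wpM2l//; first exact: ltW.
apply: le_trans (ler_norm _) _; rewrite normrM; apply: ler_pM => //.
  have := interp_le t e t0; have := gibbs_le t e t0.
  by have := interp_gt0 t e t0; have := gibbs_gt0 t e; rewrite ler_norml; lra.
apply: le_trans (ln_interp_gibbs t e t0) _; rewrite ler_wpM2l ?lerD2l//.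
by rewrite !addr_ge0// divr_ge0// ltW.
Qed.

(** The weighted terms sum to 0 and each of the others is at least minus its share of
    [entropic_gap]. *)
Lemma balanced_term_le t x e : 0 <= t -> (forall e, 0 < x e) -> balanced t x ->
  (x e - interp t e) * (ln (x e) - ln (gibbs t e)) <= (l e)^-1 * entropic_gap t.
Proof.
move=> t0 x0; rewrite /balanced (bigD1 e)//= => /eqP.
rewrite addr_eq0 -sumrN => /eqP h; rewrite ler_pdivlMl// h /entropic_gap.
rewrite [leRHS](bigD1 e)//= -[leLHS]add0r lerD//.
  rewrite mulr_ge0//; first exact: ltW.
  by rewrite log_gap_ge0 ?interp_gt0 ?gibbs_gt0.
apply: ler_sum => i _; rewrite -mulrN ler_wpM2l//; first exact: ltW.
by rewrite lerNl log_gap_lower ?interp_gt0 ?gibbs_gt0.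
Qed.

(** On [[0, T]] the gap is bounded while [interp] and [gibbs] stay away from 0. The bound [m]
    depends on neither [t] nor [x], as the continuation argument requires. *)
Lemma balanced_away0 T : 0 <= T -> exists2 m, 0 < m &
  forall t x e, 0 <= t <= T -> (forall e, 0 < x e) -> balanced t x -> m <= x e.
Proof.
move=> T0; have [M gM] := entropic_gap_bounded T.
pose M' e := (l e)^-1 * `|M|.
pose a0 e := expR (- T) * sigma0 e.
pose k e := ln (sigma0 e) + (dq e - T * s e) / l e.
pose m e := Num.min (a0 e / 2) (expR (k e - 2 * M' e / a0 e)).
have m0 e : 0 < m e.
  by rewrite lt_min expR_gt0 andbT divr_gt0// mulr_gt0 ?expR_gt0.
have mle t x e : 0 <= t <= T -> (forall e, 0 < x e) -> balanced t x -> m e <= x e.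
  move=> /andP[t0 tT] x0 bx.
  apply: (log_gap_away0 _ (interp t e) (gibbs t e)) => //.
  - rewrite mulr_gt0 ?expR_gt0//=; have /andP[h _] := interp_bounds t e t0.
    by apply: le_trans h; rewrite ler_pM2r// ler_expR lerN2.
  - rewrite ln_gibbs lerD2l ler_pM2r ?invr_gt0// lerD2l lerN2.
    by rewrite ler_wpM2r.
  - by rewrite mulr_ge0// invr_ge0 ltW.
  apply: le_trans (balanced_term_le _ _ e t0 x0 bx) _.
  rewrite ler_pM2l ?invr_gt0//; apply: le_trans (ler_norm _).
  by apply: gM; rewrite t0.
(* The default 1 keeps the minimum positive for an empty arc set. *)
exists (\big[Num.min/1]_e m e).
  by elim/big_ind: _ => // u v u0 v0; rewrite lt_min u0.
move=> t x e tT x0 bx; apply: le_trans (mle t x e tT x0 bx).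
exact: bigmin_le_cond.
Qed.

Lemma balanced_cvg (x : R -> A -> R) e :
  (forall t e, 0 <= t -> 0 < x t e) -> (forall t, 0 <= t -> balanced t (x t)) ->
  exp_decay (fun t => x t e - fhat e).
Proof.
move=> x0 bx.
pose g t := (l e)^-1 * entropic_gap t.
have dg : exp_decay g := exp_decayZ _ _ exp_decay_entropic_gap.
have B0 : 0 < bound e.
  by apply: lt_le_trans (gibbs_le 0 e (lexx _)); exact: gibbs_gt0.
have dxi : exp_decay (fun t => x t e - interp t e).
  apply: exp_decay_sqrt.
  apply: (exp_decay_le 0 _ _ (exp_decayD _ _ (exp_decayD _ _
     (exp_decayZ 2 _ (exp_decayX _ 1 (exp_decay_interp_gibbs e)))
     (exp_decayZ 2 _ (exp_decayX _ 1 dg))) (exp_decayZ (4 * bound e) _ dg))).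
  move=> t t0; rewrite ger0_norm ?sqr_ge0//.
  have := log_gap_close (x t e) (interp t e) (gibbs t e) (bound e) (g t).
  have -> : 4 * g t * bound e = 4 * bound e * g t by ring.
  apply.
  - exact: x0.
  - by rewrite interp_gt0// interp_le.
  - by rewrite gibbs_gt0 gibbs_le.
  - by rewrite mulr_ge0 ?entropic_gap_ge0// invr_ge0 ltW.
  - by apply: balanced_term_le => // [?|]; [exact: x0|exact: bx].
have d1 := @exp_decay_expR R 1 ltr01.
have := exp_decayD _ _ dxi (exp_decayZ (sigma0 e - fhat e) _ d1).
by congr exp_decay; apply/funext => t; rewrite /interp mul1r; ring.
Qed.
End EntropicBalance.

(** * Invariants and positivity of the dynamics *)

(** Mean value theorem, with right continuity at 0 because the solver has a one-sided derivative
    there. *)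
Lemma constant_of_derive0 (R : realType) (f : R -> R) (t : R) : 0 < t ->
  (forall x : R, 0 < x <= t -> is_derive x (1 : R) f 0) ->
  f x @[x --> (0 : R)^'+] --> f 0 -> f t = f 0.
Proof.
move=> t0 df f0.
have cf x : 0 < x <= t -> {for x, continuous f}.
  move=> /df dfx; apply/differentiable_continuous/derivable1_diffP.
  exact: ex_derive.
have [x||c _] := @MVT R f (fun=> 0) 0 t t0.
- by rewrite in_itv/= => /andP[x0 /ltW xt]; apply: df; rewrite x0.
- apply/continuous_within_itvP => //; split => //.
    by move=> x; rewrite in_itv/= => /andP[x0 /ltW xt]; apply: cf; rewrite x0.
  by apply: cvg_at_left_filter; apply: cf; rewrite t0 lexx.
by rewrite mul0r => /eqP; rewrite subr_eq0 => /eqP.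
Qed.

Section Dynamics.
Context {R : realType} {V : finType} {E : rel V}.
Variables (l : digraph_arc E -> R) (b : V -> R).
Variables (sigma : R -> digraph_arc E -> R) (p : R -> V -> R).
Hypothesis loopless : irreflexive E.
Hypothesis l_gt0 : forall e, 0 < l e.
Hypothesis solver : physarum_solver b l sigma p.

Lemma currentE t e : current l (sigma t) (p t) e =
  sigma t e * (potential_drop (p t) e / l e).
Proof. by rewrite /current mulrA. Qed.

Lemma current_flow t : 0 <= t -> is_flow b (current l (sigma t) (p t)).
Proof.
move=> t0 i; have [_ /(_ t t0)[/(_ i) <- _] _ _] := solver.
under [RHS]eq_bigr do rewrite mulr_suml.
rewrite exchange_big; apply: eq_bigr => e _.
rewrite currentE -sum_boundary// mulr_suml !mulr_sumr.
by apply: eq_bigr => j _; ring.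
Qed.

Lemma sigma_cvg0 e : sigma t e @[t --> (0 : R)^'+] --> sigma 0 e.
Proof.
have [_ _ _ /(_ e) d0] := solver.
have h0 : (t : R) @[t --> (0 : R)^'+] --> (0 : R).
  by apply: cvg_at_right_filter; exact: cvg_id.
have h1 : t * (t^-1 * (sigma t e - sigma 0 e)) + sigma 0 e @[t --> (0 : R)^'+] -->
    0 * (current l (sigma 0) (p 0) e - sigma 0 e) + sigma 0 e.
  by apply: cvgD; [exact: cvgM h0 d0|exact: cvg_cst].
rewrite mul0r add0r in h1; apply: (cvg_trans _ h1); apply: near_eq_cvg.
near=> t; have t0 : 0 < t by [].
by rewrite /= mulVKf ?gt_eqF// subrK.
Unshelve. all: by end_near. Qed.

Lemma sigma_derive (t : R) e : 0 < t -> is_derive t (1 : R) (fun t : R => sigma t e)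
  (current l (sigma t) (p t) e - sigma t e).
Proof. by have [_ _ d _] := solver; exact: d. Qed.

Lemma sigma_continuous (t : R) e :
  0 < t -> {for t, continuous (fun t => sigma t e)}.
Proof.
move=> /(sigma_derive t e) dt; apply/differentiable_continuous/derivable1_diffP.
exact: ex_derive.
Qed.

(** The divergence of [sigma] relaxes to [b]: [expR t] times their difference has zero
    derivative. *)
Lemma sigma_flow (t : R) i : 0 <= t ->
  \sum_e boundary i e * sigma t e =
  (1 - expR (- t)) * b i + expR (- t) * \sum_e boundary i e * sigma 0 e.
Proof.
rewrite le_eqVlt => /orP[/eqP <-|t0].
  by rewrite oppr0 expR0 subrr mul0r add0r mul1r.
pose F t := expR t * (\sum_e boundary i e * sigma t e - b i).
have : F t = F 0.
  apply: constant_of_derive0 => // [x /andP[x0 _]|].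
    have dS : is_derive x (1 : R) (fun t => \sum_e boundary i e * sigma t e)
        (b i - \sum_e boundary i e * sigma x e).
      rewrite -(current_flow x (ltW x0) i) -sumrB.
      apply: is_derive_bigsum => e; have dx := sigma_derive x e x0.
      by apply: is_derive_eq; rewrite /GRing.scale /=; ring.
    by rewrite /F; apply: is_derive_eq; rewrite /GRing.scale /=; ring.
  apply: cvgM; first by apply: cvg_at_right_filter; exact: continuous_expR.
  apply: cvgB; last exact: cvg_cst.
  apply: (cvg_big add_continuous) => e _.
  by apply: cvgM; [exact: cvg_cst|exact: sigma_cvg0].
rewrite /F expR0 mul1r expRN => h.
apply: (@mulfI _ (expR t)); first by rewrite expR_eq0.
have -> : \sum_e boundary i e * sigma 0 e =
  expR t * (\sum_e boundary i e * sigma t e - b i) + b i by rewrite h subrK.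
by field; rewrite expR_eq0.
Qed.

(** While [sigma > 0], the derivative of [l e * ln (sigma t e)] is a potential drop minus [l e], and
    circulations annihilate potential drops. *)
Lemma circulation_log_invariant y (t : R) : is_flow (fun=> 0) y -> 0 <= t ->
  (forall x e, 0 <= x <= t -> 0 < sigma x e) ->
  \sum_e y e * l e * (ln (sigma t e) - ln (sigma 0 e)) = - (t * cost l y).
Proof.
move=> cy; rewrite le_eqVlt => /orP[/eqP <- _|t0 pos].
  by rewrite mul0r oppr0 big1// => e _; rewrite subrr mulr0.
pose F t := \sum_e y e * l e * ln (sigma t e) + t * cost l y.
suff : F t = F 0.
  rewrite /F mul0r addr0 => /eqP; rewrite eq_sym -subr_eq => /eqP h.
  under eq_bigr do rewrite mulrBr.
  by rewrite sumrB -h; ring.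
apply: constant_of_derive0 => // [x /andP[x0 xt]|].
  have dS : is_derive x (1 : R) (fun t => \sum_e y e * l e * ln (sigma t e))
      (- cost l y).
    have -> : - cost l y = \sum_e (y e * potential_drop (p x) e - l e * y e).
      by rewrite sumrB circulation_drop// sub0r.
    apply: is_derive_bigsum => e; have dx := sigma_derive x e x0.
    have sx : 0 < sigma x e by apply: pos; rewrite (ltW x0).
    have dln := is_derive1_ln sx.
    have dc : is_derive x (1 : R) (fun t => ln (sigma t e))
       ((sigma x e)^-1 * (current l (sigma x) (p x) e - sigma x e)).
      exact: (@is_derive1_comp R (@ln R) (fun t : R => sigma t e) x _ _ dln dx).
    apply: is_derive_eq; rewrite /GRing.scale /= currentE.
    by field; rewrite !gt_eqF.
  by rewrite /F; apply: is_derive_eq; rewrite /GRing.scale /=; ring.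
apply: cvgD; last first.
  by apply: cvgM; [apply: cvg_at_right_filter; exact: cvg_id|exact: cvg_cst].
apply: (cvg_big add_continuous) => e _; apply: cvgM; first exact: cvg_cst.
have s0 : 0 < sigma 0 e by apply: pos; rewrite lexx ltW.
exact: (@continuous_cvg _ _ _ _ _ _ (@ln R) (sigma 0 e) (continuous_ln s0)
  (sigma_cvg0 e)).
Qed.

Variables (fhat : digraph_arc E -> R) (q pstar : V -> R).
Hypothesis fhat_flow : is_flow b fhat.
Hypothesis pstar_le : forall e, potential_drop pstar e <= l e.
Hypothesis fhat_tight : forall e, potential_drop pstar e = l e ->
  fhat e = sigma 0 e * expR (potential_drop q e / l e).
Hypothesis fhat_slack : forall e, potential_drop pstar e < l e -> fhat e = 0.

Let s (e : digraph_arc E) := l e - potential_drop pstar e.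
Let dq (e : digraph_arc E) := potential_drop q e.

Lemma sigma0_gt0 e : 0 < sigma 0 e.
Proof. by have [] := solver. Qed.

Lemma slack_ge0 e : 0 <= s e.
Proof. by rewrite subr_ge0. Qed.

Lemma slack_eq0 e : s e = 0 -> fhat e = sigma 0 e * expR (dq e / l e).
Proof. by move=> /eqP; rewrite subr_eq0 eq_sym => /eqP /fhat_tight. Qed.

Lemma slack_gt0 e : 0 < s e -> fhat e = 0.
Proof. by rewrite subr_gt0 => /fhat_slack. Qed.

Lemma solver_balanced (t : R) :
  0 <= t -> (forall x e, 0 <= x <= t -> 0 < sigma x e) ->
  balanced l (sigma 0) fhat s dq t (sigma t).
Proof.
move=> t0 pos; pose y e := sigma t e - interp (sigma 0) fhat t e.
have cy : is_flow (fun=> 0) y.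
  move=> i; under eq_bigr do rewrite mulrBr.
  rewrite sumrB sigma_flow// -fhat_flow !mulr_sumr -big_split -sumrB big1// => e _.
  by rewrite /interp /=; ring.
have h1 := circulation_log_invariant y t cy t0 pos.
have h2 := circulation_drop loopless y q cy.
have h3 := circulation_drop loopless y pstar cy.
(* Expanding [ln (gibbs t e)] yields the invariant plus drops of [q] and [pstar] paired with the
   circulation [y], which vanish. *)
rewrite /balanced; transitivity (
  \sum_e y e * l e * (ln (sigma t e) - ln (sigma 0 e))
  + t * cost l y - \sum_e y e * potential_drop q e
  - t * \sum_e y e * potential_drop pstar e); last by rewrite h1 h2 h3; ring.
rewrite /cost !mulr_sumr -big_split -!sumrB; apply: eq_bigr => e _ /=.
rewrite ln_gibbs; last exact: sigma0_gt0.
by rewrite /y /s /dq; field; rewrite gt_eqF.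
Qed.

(** Continuation: let [T] be the infimum of the times at which positivity fails. Before [T] the
    balance holds, so [sigma >= m > 0]; continuity carries this to [T] and positivity slightly
    beyond, a contradiction. *)
Lemma sigma_gt0 (t : R) e : 0 <= t -> 0 < sigma t e.
Proof.
move: t e; suff : ~ exists t, 0 <= t /\ exists e, sigma t e <= 0.
  move=> nbad t e t0; rewrite ltNge; apply/negP => te; apply: nbad.
  by exists t; split => //; exists e.
move=> [t1 bad1].
pose S := [set t | 0 <= t /\ exists e, sigma t e <= 0].
have S0 : S !=set0 by exists t1.
have lbS : lbound S 0 by move=> t [].
pose T := inf S.
have T0 : 0 <= T by exact: lb_le_inf.
have posT t e : 0 <= t < T -> 0 < sigma t e.
  move=> /andP[t0]; rewrite !ltNge => /negP tT; apply/negP => te; apply: tT.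
  by apply: ge_inf; [exists 0|split => //; exists e].
have later d : 0 < d ->
    (forall t, 0 <= t -> T <= t < T + d -> forall e, 0 < sigma t e) -> False.
  move=> d0 posd; suff : T + d <= T by lra.
  apply: lb_le_inf => // t St; have Tt : T <= t by apply: ge_inf => //; exists 0.
  rewrite leNgt; apply/negP => td; case: St => t0 [e].
  by apply/negP; rewrite -ltNge; apply: posd => //; rewrite Tt.
(* At [T = 0] the initial state and right continuity replace the balance. *)
have [T_eq0|/eqP TN0] := pselect (T = 0).
  have : \forall t \near (0 : R)^'+, forall e, 0 < sigma t e.
    apply: filter_forall => e; exact: (cvgr_gt _ (sigma_cvg0 e) _ (sigma0_gt0 e)).
  rewrite near_withinE => /nbhs_ballP[d /= d0 dP]; apply: (later d d0) => t t0.
  rewrite T_eq0 add0r => /andP[_ td] e.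
  have [->|tN0] := eqVneq t 0; first exact: sigma0_gt0.
  apply: dP; first by rewrite /ball /= sub0r normrN ger0_norm.
  by rewrite lt_neqAle eq_sym tN0.
have Tgt0 : 0 < T by rewrite lt_neqAle eq_sym TN0.
have [m m0 mP] := balanced_away0 l (sigma 0) fhat s dq l_gt0 sigma0_gt0 slack_ge0
  slack_eq0 slack_gt0 T T0.
have mT e : m <= sigma T e.
  apply: (@cvgr_to_ge _ (T^'-) _ _ (fun t => sigma t e)).
    by apply: cvg_at_left_filter; exact: sigma_continuous.
  near=> t; have tT : t < T by [].
  have t0 : 0 <= t by near: t; apply: nbhs_left_ge.
  apply: (mP t) => [|e'|]; first by apply/andP; split; [exact: t0|exact: ltW].
    by apply: posT; apply/andP; split; [exact: t0|exact: tT].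
  apply: solver_balanced => // x e' /andP[x0 xt].
  by apply: posT; rewrite x0 (le_lt_trans xt).
have : \forall t \near T, forall e, 0 < sigma t e.
  apply: (@filter_forall _ _ (fun e t => 0 < sigma t e) (nbhs T)) => e.
  exact: (cvgr_gt _ (sigma_continuous T e Tgt0) _ (lt_le_trans m0 (mT e))).
move=> /nbhs_ballP[d /= d0 dP]; apply: (later d d0) => t t0 /andP[Tt td] e.
by apply: dP; rewrite /ball /= distrC ger0_norm; lra.
Unshelve. all: by end_near. Qed.

Lemma sigma_cvg e : exp_decay (fun t => sigma t e - fhat e).
Proof.
apply: (balanced_cvg l (sigma 0) fhat s dq l_gt0 sigma0_gt0 slack_ge0
  slack_eq0 slack_gt0).
  by move=> t e'; exact: sigma_gt0.
by move=> t t0; apply: solver_balanced => // x e' /andP[x0 _]; exact: sigma_gt0.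
Qed.
End Dynamics.

(** * Convergence of the current *)

Section Current.
Context {R : realType} {V : finType} {E : rel V}.
Variables (l : digraph_arc E -> R) (b : V -> R).
Variables (sigma : R -> digraph_arc E -> R) (p : R -> V -> R).
Variables (fhat : digraph_arc E -> R) (pstar : V -> R).
Hypothesis loopless : irreflexive E.
Hypothesis l_gt0 : forall e, 0 < l e.
Hypothesis fhat_flow : is_flow b fhat.
Hypothesis fhat_tight : forall e, potential_drop pstar e = l e -> 0 < fhat e.
Hypothesis fhat_slack : forall e, potential_drop pstar e <> l e -> fhat e = 0.
Hypothesis sigma_pos : forall t e, 0 <= t -> 0 < sigma t e.
Hypothesis flow_current : forall t, 0 <= t -> is_flow b (current l (sigma t) (p t)).
Hypothesis sigma_fhat : forall e, exp_decay (fun t => sigma t e - fhat e).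

(* [current - fhat] is a circulation, hence orthogonal both to
   [l * current / sigma] (the potential drops of [p]) and to the potential
   drops of [pstar]. *)
Lemma dissipation_identity (t : R) : 0 <= t ->
  let d e := current l (sigma t) (p t) e - fhat e in
  \sum_e l e * d e ^+ 2 / sigma t e =
  \sum_e (l e * d e * (sigma t e - fhat e) / sigma t e -
    (l e - potential_drop pstar e) * d e).
Proof.
move=> t0 d.
have cd : is_flow (fun=> 0) d by apply: is_flowB fhat_flow; exact: flow_current.
have h1 := circulation_drop loopless d (p t) cd.
have h2 := circulation_drop loopless d pstar cd.
apply/eqP; rewrite -subr_eq0; apply/eqP.
transitivity (\sum_e d e * potential_drop (p t) e
   - \sum_e d e * potential_drop pstar e); last by rewrite h1 h2 subrr.
rewrite -!sumrB; apply: eq_bigr => e _.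
have se := sigma_pos t e t0.
have -> : potential_drop (p t) e = l e * (d e + fhat e) / sigma t e.
  rewrite /d subrK /current -/(potential_drop (p t) e).
  by field; rewrite !gt_eqF.
by field; rewrite gt_eqF.
Qed.

(** Completing squares in the dissipation identity bounds its right-hand side by half of the left
    plus decaying remainders [r]. Hence the dissipation decays, and with it the deviation, since
    [sigma] is bounded. *)
Lemma current_cvg e : exp_decay (fun t => current l (sigma t) (p t) e - fhat e).
Proof.
pose d t e := current l (sigma t) (p t) e - fhat e.
pose s (e : digraph_arc E) := l e - potential_drop pstar e.
(* On tight arcs the coefficient uses [sigma >= fhat / 2], valid eventually; on slack arcs
   [fhat = 0] and the two linear terms combine to [(l e - s e) * d t e]. *)
pose r (e : digraph_arc E) t := if s e == 0
  then l e / fhat e * (sigma t e - fhat e) ^+ 2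
  else (l e - s e) ^+ 2 / (2 * l e) * (sigma t e - fhat e).
have rd i : exp_decay (r i).
  rewrite /r; case: eqP => _; apply: exp_decayZ; last exact: sigma_fhat.
  exact: (exp_decayX _ 1 (sigma_fhat i)).
have term_le i : exists T, 0 <= T /\ forall t, T <= t ->
    l i * d t i * (sigma t i - fhat i) / sigma t i - s i * d t i <=
    (l i * d t i ^+ 2 / sigma t i) / 2 + r i t.
  rewrite /r; have [si|/eqP si] := eqVneq (s i) 0.
    have fi : 0 < fhat i.
      by apply: fhat_tight; move/eqP: si; rewrite subr_eq0 => /eqP.
    have [T T0 TP] := exp_decay_lt _ (fhat i / 2) (sigma_fhat i)
      (divr_gt0 fi (ltr0Sn _ 1)).
    exists T; split=> // t Tt; have := TP t Tt; rewrite ltr_norml => /andP[lo _].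
    have st : fhat i / 2 <= sigma t i by lra.
    have st0 : 0 < sigma t i by lra.
    have li := l_gt0 i.
    rewrite si mul0r subr0.
    apply: le_trans (_ : l i * d t i ^+ 2 / sigma t i / 2 +
       l i / (2 * sigma t i) * (sigma t i - fhat i) ^+ 2 <= _); last first.
      rewrite lerD2l ler_wpM2r ?sqr_ge0// ler_pM2l// lef_pV2 ?posrE; lra.
    rewrite -subr_ge0.
    have -> : l i * d t i ^+ 2 / sigma t i / 2 + l i / (2 * sigma t i) *
       (sigma t i - fhat i) ^+ 2 - l i * d t i * (sigma t i - fhat i) / sigma t i =
       l i / (2 * sigma t i) * (d t i - (sigma t i - fhat i)) ^+ 2.
      by field; rewrite gt_eqF.
    by rewrite mulr_ge0 ?sqr_ge0// divr_ge0; lra.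
  exists 0; split=> // t t0; rewrite fhat_slack; last first.
    by move=> h; apply: si; rewrite /s h subrr.
  have st0 := sigma_pos t i t0; have li := l_gt0 i.
  rewrite subr0 -subr_ge0.
  have -> : l i * d t i ^+ 2 / sigma t i / 2 +
      (l i - s i) ^+ 2 / (2 * l i) * sigma t i -
      (l i * d t i * sigma t i / sigma t i - s i * d t i) =
      (l i * d t i - (l i - s i) * sigma t i) ^+ 2 / (2 * l i * sigma t i).
    by field; rewrite !gt_eqF.
  by rewrite divr_ge0 ?sqr_ge0// !mulr_ge0// ltW.
have [T0 T0P] := choice term_le.
have [T1 T1_ge0 T1P] := exp_decay_lt _ 1 (sigma_fhat e) ltr01.
have T0_ge0 i : 0 <= T0 i by have [] := T0P i.
(* The sum of the nonnegative thresholds dominates each of them. *)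
apply: exp_decay_sqrt; apply: (exp_decay_le (T1 + \sum_i T0 i) _ _
  (exp_decayZ (2 * (fhat e + 1) / l e) _ (exp_decay_sum _ r rd))) => t Tt.
have sumT0 : 0 <= \sum_i T0 i by apply: sumr_ge0.
have t0 : 0 <= t by lra.
have T0t i : T0 i <= t.
  apply: le_trans Tt; rewrite (bigD1 i)//= addrCA lerDl addr_ge0//.
  exact: sumr_ge0.
rewrite ger0_norm ?sqr_ge0// -/(d t e).
pose w i := l i * d t i ^+ 2 / sigma t i.
have w0 i : 0 <= w i.
  have li := l_gt0 i; have si := sigma_pos t i t0.
  by apply: divr_ge0; [apply: mulr_ge0; [exact: ltW|exact: sqr_ge0]|exact: ltW].
have wr : \sum_i w i <= (\sum_i w i) / 2 + \sum_i r i t.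
  rewrite [leLHS](dissipation_identity t t0) mulr_suml -big_split.
  by apply: ler_sum => i _; exact: (proj2 (T0P i)).
have we : w e <= \sum_i w i by rewrite (bigD1 e)//= lerDl sumr_ge0.
have := T1P t ltac:(lra); rewrite ltr_norml => /andP[_ se].
have li := l_gt0 e; have si := sigma_pos t e t0.
have -> : d t e ^+ 2 = sigma t e / l e * w e by rewrite /w; field; rewrite !gt_eqF.
have -> : 2 * (fhat e + 1) / l e * \sum_i r i t =
  (fhat e + 1) / l e * (2 * \sum_i r i t) by ring.
apply: ler_pM => //; [by apply: divr_ge0; exact: ltW| |by lra].
by rewrite ler_pM2r ?invr_gt0//; lra.
Qed.
End Current.

(** * Optimality of the limit flow and a common rate *)

Theorem theorem1 (R : realType) (V : finType) (E : rel V)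
  (loopless : irreflexive E)
  (connectedG : digraph_connected E)
  (l : digraph_arc E -> R) (l_gt0 : forall e : digraph_arc E, 0 < l e)
  (b : V -> R) (sum_b : \sum_(i : V) b i = 0)
  (feasible : @positive_flows R V E b !=set0)
  (sigma : R -> digraph_arc E -> R) (p : R -> V -> R)
  (solver : physarum_solver b l sigma p) :
  exists phihat : digraph_arc E -> R,
    [/\ optimal_flows b l phihat,
        (exists a T : R, [/\ 0 < a, 0 <= T &
           forall (e : digraph_arc E) (t : R), T <= t ->
             `|current l (sigma t) (p t) e - phihat e| <= expR (- (a * t))]) &
        supp phihat = optimal_arcs b l].
Proof.
have [f fopt fpos] := full_support_optimal_flow b l
  (optimal_flows_nonempty loopless b l l_gt0 feasible).
have [pstar pstarP] := strict_complementarity loopless b l f fopt fpos.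
have [[bf fge0] fmin] := fopt.
have foff e : ~ optimal_arcs b l e -> f e = 0.
  by move=> noe; apply: contra_notP noe => /eqP fe; exists f.
have s0 : forall e, 0 < sigma 0 e by have [] := solver.
have [q bfhat] := entropic_center _ _ _ loopless b l f (sigma 0) (optimal_arcs b l)
  l_gt0 s0 bf fpos foff.
set fhat := (fun e => _) in bfhat.
have pstar_le e : potential_drop pstar e <= l e.
  have [on off] := pstarP e.
  by have [/on ->|/off/ltW] := pselect (optimal_arcs b l e).
have fhat_on e : optimal_arcs b l e ->
    fhat e = sigma 0 e * expR (potential_drop q e / l e).
  by rewrite /fhat; case: asboolP.
have fhat_off e : ~ optimal_arcs b l e -> fhat e = 0.
  by rewrite /fhat; case: asboolP.
have fhat_pos e : optimal_arcs b l e -> 0 < fhat e.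
  by move=> /fhat_on ->; rewrite mulr_gt0 ?expR_gt0.
have tightP e : potential_drop pstar e = l e -> optimal_arcs b l e.
  move=> te; apply: contrapT => noe; have [_ /(_ noe)] := pstarP e.
  by rewrite te ltxx.
have slackP e : potential_drop pstar e <> l e -> ~ optimal_arcs b l e.
  by move=> te oe; apply: te; have [->] := pstarP e.
have slackP' e : potential_drop pstar e < l e -> fhat e = 0.
  by move=> /lt_eqF/eqP/slackP/fhat_off.
(* Complementary slackness: [g - fhat] is a circulation and [fhat] vanishes where the reduced cost
   does not, so the excess cost of [g] is its reduced cost. *)
have fhat_cost g : positive_flows b g ->
    cost l fhat + \sum_e (l e - potential_drop pstar e) * g e = cost l g.
  move=> [bg _].
  have := circulation_drop loopless _ pstar (is_flowB _ _ _ bg bfhat).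
  move=> h; apply/eqP; rewrite -subr_eq0; apply/eqP.
  rewrite -[RHS]oppr0 -[X in _ = - X]h -[RHS]sumrN /cost -big_split -sumrB.
  apply: eq_bigr => e _ /=.
  have [te|/eqP/slackP/fhat_off ->] := eqVneq (potential_drop pstar e) (l e).
    by rewrite te; ring.
  by ring.
have opt_fhat : optimal_flows b l fhat.
  split=> [|g pg].
    split=> // e.
    by have [/fhat_pos/ltW|/fhat_off ->] := pselect (optimal_arcs b l e).
  rewrite -(fhat_cost g pg) lerDl; apply: sumr_ge0 => e _.
  by rewrite mulr_ge0 ?subr_ge0//; case: pg.
exists fhat; split => //; last first.
  apply/seteqP; split=> [e fe|e /fhat_pos fe]; last by rewrite /supp /= gt_eqF.
  by exists fhat.
have sc := sigma_cvg l b sigma p loopless l_gt0 solver fhat q pstar bfhat pstar_le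
  (fun e te => fhat_on e (tightP e te)) slackP'.
have sp := sigma_gt0 l b sigma p loopless l_gt0 solver fhat q pstar bfhat pstar_le
  (fun e te => fhat_on e (tightP e te)) slackP'.
have fc := current_flow l b sigma p loopless solver.
have cc := current_cvg l b sigma p fhat pstar loopless l_gt0 bfhat
  (fun e te => fhat_pos e (tightP e te))
  (fun e te => fhat_off e (slackP e te)) sp fc sc.
(* Summing the absolute deviations gives one rate and one threshold for all arcs. *)
have [a [T [a0 T0 aT]]] := exp_decay_rate _
  (exp_decay_sum _ _ (fun e => exp_decay_norm _ (cc e))).
exists a, T; split => // e t Tt; apply: le_trans (aT t Tt).
apply: le_trans (ler_norm _); rewrite (bigD1 e)//= lerDl.
exact: sumr_ge0.
Qed.
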